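(* Let $f\in\mathbb{R}[\mathbf{x}]$ be a form (homogeneous polynomial) of degree $d$ in $\mathbf{x}=(x_1,\dots,x_n)$. Suppose that $f$ admits a correlative sparsity pattern $(\mathbf{x}(1),\dots,\mathbf{x}(p))$ satisfying the running intersection property. (1) If $f\ge0$ on $\mathbb{R}^n$, then for any $\epsilon>0$ there exist $\sigma_\ell\in\Sigma[\mathbf{x}(\ell)\cup\{w_\ell\}]$ and $\tau_\ell\in\mathbb{R}[\mathbf{x}(\ell)\cup\{w_\ell\}]$, $\ell=1,\dots,p$, such that $$f+\epsilon\left(\sum_{i=1}^n x_i^d+\sum_{\ell=1}^p w_\ell^d\right)=\sum_{\ell=1}^p\left(\sigma_\ell+\tau_\ell\left(\|\mathbf{x}(\ell)\|^2+w_\ell^2-1\right)\right).$$ (2) If $f$ is positive definite (i.e. $f(\mathbf{x})>0$ for all nonzero $\mathbf{x}\in\mathbb{R}^n$), then for any $\epsilon>0$ there exist $\sigma_\ell\in\Sigma[\mathbf{x}(\ell)\cup\{w_\ell\}]$ and $\tau_\ell\in\mathbb{R}[\mathbf{x}(\ell)\cup\{w_\ell\}]$, $\ell=1,\dots,p$, such that $$f+\epsilon\sum_{\ell=1}^p w_\ell^d=\sum_{\ell=1}^p\left(\sigma_\ell+\tau_\ell\left(\|\mathbf{x}(\ell)\|^2+w_\ell^2-1\right)\right).$$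
   Context: Here $w_1,\dots,w_p$ are auxiliary variables, one for each clique, and identities are between polynomials in $\mathbb{R}[x_1,\dots,x_n,w_1,\dots,w_p]$. For a set of variables $V$, $\Sigma[V]$ denotes the set of sums of squares of polynomials in $\mathbb{R}[V]$. $\|\mathbf{x}(\ell)\|^2=\sum_{x_i\in\mathbf{x}(\ell)}x_i^2$. A polynomial $f$ admits the correlative sparsity pattern $(\mathbf{x}(1),\dots,\mathbf{x}(p))$, where $\mathbf{x}(\ell)\subseteq\{x_1,\dots,x_n\}$ and $\bigcup_\ell\mathbf{x}(\ell)=\{x_1,\dots,x_n\}$, if $f=\sum_{\ell=1}^pf_\ell$ with $f_\ell\in\mathbb{R}[\mathbf{x}(\ell)]$. The pattern satisfies the running intersection property if for every $\ell\in\{1,\dots,p-1\}$ there is $s\in\{1,\dots,\ell\}$ with $\mathbf{x}(\ell+1)\cap\bigcup_{j=1}^{\ell}\mathbf{x}(j)\subseteq\mathbf{x}(s)$.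
   Formalization: In (1), the zero form is allowed only for even d (for f = 0 and d odd, at x = 0 and all w_ℓ = −1 the left side is negative while the right side is nonnegative); it is also assumed that n ≥ 1 (for n = 0, part (2) fails for f = −1). *)

(* Defs.v *)
From mathcomp Require Import all_boot all_order all_algebra.
From mathcomp Require Import reals.
From mathcomp Require Import mpoly.

Set Implicit Arguments.
Unset Strict Implicit.
Unset Printing Implicit Defensive.

Import Order.TTheory GRing.Theory Num.Theory.
Local Open Scope ring_scope.

(* q \in R[V]: only the variables indexed by V occur in q *)
Definition in_vars (R : realType) (k : nat) (V : {set 'I_k})
    (q : {mpoly R[k]}) : Prop :=
  forall m : 'X_{1..k}, m \in msupp q ->
  forall i : 'I_k, i \notin V -> m i = 0%N.

(* q \in \Sigma[V] *)
Definition sos_in_vars (R : realType) (k : nat) (V : {set 'I_k})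
    (q : {mpoly R[k]}) : Prop :=
  exists2 s : seq {mpoly R[k]},
    (forall g, g \in s -> in_vars V g) & q = \sum_(g <- s) g ^+ 2.

Definition sparsity_pattern (R : realType) (n p : nat)
    (x : 'I_p -> {set 'I_n}) (f : {mpoly R[n]}) : Prop :=
  \bigcup_(l < p) x l = [set: 'I_n] /\
  exists2 fl : 'I_p -> {mpoly R[n]},
    (forall l, in_vars (x l) (fl l)) & f = \sum_(l < p) fl l.

(* Cliques are numbered from 0, so every clique but the first is concerned. *)
Definition running_intersection (n p : nat)
    (x : 'I_p -> {set 'I_n}) : Prop :=
  forall l : 'I_p, (0 < l)%N ->
  exists2 s : 'I_p, (s < l)%N &
    x l :&: \bigcup_(j < p | (j < l)%N) x j \subset x s.

(* R[x_1..x_n, w_1..w_p] is {mpoly R[n + p]}: first the x's, then the w's. *)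
Definition varx (R : realType) (n p : nat) (i : 'I_n) : {mpoly R[n + p]} :=
  'X_(lshift p i).

Definition varw (R : realType) (n p : nat) (l : 'I_p) : {mpoly R[n + p]} :=
  'X_(rshift n l).

Definition embed_x (R : realType) (n p : nat) (f : {mpoly R[n]}) :
    {mpoly R[n + p]} :=
  f \mPo [tuple varx R p i | i < n].

(* the variables x(l) together with w_l *)
Definition clique_w (n p : nat) (x : 'I_p -> {set 'I_n}) (l : 'I_p) :
    {set 'I_(n + p)} :=
  rshift n l |: [set lshift p i | i in x l].

(* ||x(l)||^2 + w_l^2 - 1 *)
Definition clique_sphere (R : realType) (n p : nat)
    (x : 'I_p -> {set 'I_n}) (l : 'I_p) : {mpoly R[n + p]} :=
  \sum_(i in x l) varx R p i ^+ 2 + varw R n l ^+ 2 - 1.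

(* Main.v *)
Require Import Defs.
From mathcomp Require Import all_boot all_order all_algebra.
From mathcomp Require Import reals.
From mathcomp Require Import mpoly.
From mathcomp Require boolp classical_sets filter topology normedtype.
From mathcomp Require Import ring lra.

Set Implicit Arguments.
Unset Strict Implicit.
Unset Printing Implicit Defensive.

Import Order.TTheory GRing.Theory Num.Theory.
Local Open Scope ring_scope.

(** The left-hand side of each identity is positive at every common zero of
    the clique spheres, so both parts follow from a sparse Putinar theorem for
    spheres, [sparse_putinar_spheres]: if q is a sum of polynomials q_l in the
    variables of cliques I_l with the running intersection property, and q > 0
    wherever all the polynomials g_l = [sphere (I_l)] vanish, then
    q = sum_l (sigma_l + tau_l g_l) with sigma_l, tau_l in the variables of
    I_l and sigma_l a sum of squares.  That theorem has a proof by Bernstein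
    polynomials, in which both the gluing along the cliques and the
    representation inside one clique become finite problems.

    - Penalty.  By compactness of [-1,1]^k there are C and delta > 0 with
      q + C sum_l g_l^2 >= delta on the cube ([cube_penalty]).  The penalty
      respects the sparsity, so let F_l = q_l + C g_l^2.
    - Discretization.  Write each F_l in the tensor Bernstein basis of degree
      N in each variable.  Its coefficients, indexed by a grid, converge
      uniformly to the values of F_l at the corresponding nodes of the cube,
      and they depend only on the grid coordinates in I_l
      ([mbernstein_coef_near], [depends_on_mbernstein_coef]).  For large N the
      coefficients of sum_l F_l are therefore nonnegative.
    - Gluing.  A sum of functions c_l on the grid, each depending on the
      coordinates in I_l only, that is nonnegative everywhere is also a sum of
      nonnegative functions of that kind ([running_intersection_glue]):
      subtract from the last function its minimum over the coordinates that it
      does not share with its predecessors, and give this minimum to the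
      predecessor whose clique contains the shared coordinates.  As the
      Bernstein polynomials of given degree in one variable add up to 1, a
      function of the coordinates in I_l is the coefficient family of a
      polynomial in the variables of I_l, so no approximation is lost here.
    - One clique.  Modulo g_l each factor (1 + x_i) / 2 and (1 - x_i) / 2 with
      i in I_l is a sum of squares ([sphere_module_coord]), and since g_l is
      imposed as an equation the set of polynomials sigma + tau g_l is closed
      under products.  Hence it contains every nonnegative combination of
      Bernstein polynomials ([sphere_module_mbernstein]).

    For the positivity, d is even: this is a hypothesis when f = 0, and a nonzero
    form of odd degree takes values of both signs ([psd_form_even]).  On the
    sphere of a clique l some x_i or w_l is nonzero, so that one of the d-th
    powers is positive while the others are nonnegative; when f is positive
    definite, f itself is positive as soon as some x_i is nonzero. *)

(** * Polynomials in a set of variables *)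

Section InVars.
Variables (R : realType) (k : nat).
Implicit Types (V W : {set 'I_k}) (p q : {mpoly R[k]}).

Lemma in_varsX V i : i \in V -> in_vars V ('X_i : {mpoly R[k]}).
Proof.
move=> iV m; rewrite msuppX inE => /eqP -> j jV; rewrite mnmE.
by case: eqP => // ij; rewrite -ij iV in jV.
Qed.

Lemma in_varsC V c : in_vars V (c%:MP : {mpoly R[k]}).
Proof.
move=> m; rewrite msuppC; case: ifP => // _; rewrite inE => /eqP -> j _.
by rewrite mnm0E.
Qed.

Lemma in_vars0 V : in_vars V (0 : {mpoly R[k]}).
Proof. by rewrite -mpolyC0; exact: in_varsC. Qed.

Lemma in_vars1 V : in_vars V (1 : {mpoly R[k]}).
Proof. exact: in_varsC. Qed.

Lemma in_varsD V p q : in_vars V p -> in_vars V q -> in_vars V (p + q).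
Proof.
move=> Vp Vq m /msuppD_le; rewrite mem_cat => /orP[/Vp|/Vq]; exact.
Qed.

Lemma in_varsZ V c p : in_vars V p -> in_vars V (c *: p).
Proof. by move=> Vp m /msuppZ_le /Vp. Qed.

Lemma in_varsN V p : in_vars V p -> in_vars V (- p).
Proof. by move=> Vp; rewrite -scaleN1r; exact: in_varsZ. Qed.

Lemma in_varsM V p q : in_vars V p -> in_vars V q -> in_vars V (p * q).
Proof.
move=> Vp Vq m /msuppM_le /allpairsP[[m1 m2] /= [/Vp h1 /Vq h2 ->]] i iV.
by rewrite mnmDE h1 ?h2.
Qed.

Lemma in_varsXn V p a : in_vars V p -> in_vars V (p ^+ a).
Proof.
move=> Vp; elim: a => [|a IH]; first exact: in_vars1.
by rewrite exprS; exact: in_varsM.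
Qed.

Lemma in_vars_sum V (T : Type) (s : seq T) (P : pred T)
    (F : T -> {mpoly R[k]}) :
  (forall t, P t -> in_vars V (F t)) -> in_vars V (\sum_(t <- s | P t) F t).
Proof.
move=> h; apply: (big_ind (in_vars V)) => //; first exact: in_vars0.
exact: in_varsD.
Qed.

Lemma in_vars_prod V (T : Type) (s : seq T) (P : pred T)
    (F : T -> {mpoly R[k]}) :
  (forall t, P t -> in_vars V (F t)) -> in_vars V (\prod_(t <- s | P t) F t).
Proof.
move=> h; apply: (big_ind (in_vars V)) => //; first exact: in_vars1.
exact: in_varsM.
Qed.

Lemma sos_in_varsD V p q :
  sos_in_vars V p -> sos_in_vars V q -> sos_in_vars V (p + q).
Proof.
move=> [s sV ->] [t tV ->]; exists (s ++ t); last by rewrite big_cat.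
by move=> g; rewrite mem_cat => /orP[/sV|/tV].
Qed.

Lemma sos_in_varsM V p q :
  sos_in_vars V p -> sos_in_vars V q -> sos_in_vars V (p * q).
Proof.
move=> [s sV ->] [t tV ->]; exists [seq g * h | g <- s, h <- t].
  by move=> _ /allpairsP[[g h] /= [/sV gV /tV hV ->]]; exact: in_varsM.
rewrite big_allpairs_dep mulr_suml; apply: eq_bigr => g _.
by rewrite mulr_sumr; apply: eq_bigr => h _; rewrite exprMn.
Qed.

Lemma sos_in_vars_sqr V p : in_vars V p -> sos_in_vars V (p ^+ 2).
Proof.
move=> Vp; exists [:: p]; last by rewrite big_seq1.
by move=> g; rewrite inE => /eqP ->.
Qed.

Lemma sos_in_varsC V c : 0 <= c -> sos_in_vars V (c%:MP : {mpoly R[k]}).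
Proof.
move=> c0; rewrite -(sqr_sqrtr c0) rmorphXn.
by apply: sos_in_vars_sqr; exact: in_varsC.
Qed.

Lemma sos_in_vars0 V : sos_in_vars V (0 : {mpoly R[k]}).
Proof. by rewrite -mpolyC0; exact: sos_in_varsC. Qed.

Lemma sos_in_varsZ V c p : 0 <= c -> sos_in_vars V p -> sos_in_vars V (c *: p).
Proof.
move=> c0 Vp; rewrite -mul_mpolyC; apply: sos_in_varsM => //.
exact: sos_in_varsC.
Qed.

Lemma sos_in_vars_in_vars V p : sos_in_vars V p -> in_vars V p.
Proof.
move=> [s sV ->]; rewrite big_seq; apply: in_vars_sum => g /sV; exact: in_varsXn.
Qed.

End InVars.

(** * Sums of squares modulo a sphere *)

Section SphereModule.
Variables (R : realType) (k : nat).
Implicit Types (V : {set 'I_k}) (p q : {mpoly R[k]}).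

Definition sphere V : {mpoly R[k]} := \sum_(i in V) 'X_i ^+ 2 - 1.

(** The quadratic module of the sphere over the variables of V.  The multiplier
    tau is an arbitrary polynomial, which makes this set a semiring and not only
    a module over the sums of squares. *)
Definition sphere_module V q :=
  exists sigma tau,
    [/\ sos_in_vars V sigma, in_vars V tau & q = sigma + tau * sphere V].

Lemma in_vars_sphere V : in_vars V (sphere V).
Proof.
apply: in_varsD; last by apply: in_varsN; exact: in_vars1.
by apply: in_vars_sum => i iV; apply: in_varsXn; exact: in_varsX.
Qed.

Lemma sphere_moduleD V p q :
  sphere_module V p -> sphere_module V q -> sphere_module V (p + q).
Proof.
move=> [s [t [sV tV ->]]] [s' [t' [sV' tV' ->]]].
exists (s + s'), (t + t'); split; [exact: sos_in_varsD|exact: in_varsD|ring].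
Qed.

Lemma sphere_moduleM V p q :
  sphere_module V p -> sphere_module V q -> sphere_module V (p * q).
Proof.
move=> [s [t [sV tV ->]]] [s' [t' [sV' tV' ->]]].
exists (s * s'), (s * t' + t * s' + t * t' * sphere V).
split; [exact: sos_in_varsM| |ring].
have s1 := sos_in_vars_in_vars sV; have s2 := sos_in_vars_in_vars sV'.
do 2?apply: in_varsD; repeat apply: in_varsM => //; exact: in_vars_sphere.
Qed.

Lemma sphere_moduleC V c : 0 <= c -> sphere_module V c%:MP.
Proof.
move=> c0; exists c%:MP, 0; rewrite mul0r addr0.
by split; [exact: sos_in_varsC|exact: in_vars0|].
Qed.

Lemma sphere_moduleZ V c p :
  0 <= c -> sphere_module V p -> sphere_module V (c *: p).
Proof.
move=> c0 Vp; rewrite -mul_mpolyC.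
by apply: sphere_moduleM => //; exact: sphere_moduleC.
Qed.

Lemma sphere_moduleXn V p a : sphere_module V p -> sphere_module V (p ^+ a).
Proof.
move=> Vp; elim: a => [|a IH]; first exact: sphere_moduleC.
by rewrite exprS; exact: sphere_moduleM.
Qed.

Lemma sphere_module_sum V (T : Type) (s : seq T) (P : pred T)
    (F : T -> {mpoly R[k]}) :
  (forall t, P t -> sphere_module V (F t)) ->
  sphere_module V (\sum_(t <- s | P t) F t).
Proof.
move=> h; apply: (big_ind (sphere_module V)) => //; last exact: sphere_moduleD.
by rewrite -mpolyC0; exact: sphere_moduleC.
Qed.

Lemma sphere_module_prod V (T : Type) (s : seq T) (P : pred T)
    (F : T -> {mpoly R[k]}) :
  (forall t, P t -> sphere_module V (F t)) ->
  sphere_module V (\prod_(t <- s | P t) F t).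
Proof.
move=> h; apply: (big_ind (sphere_module V)) => //; last exact: sphere_moduleM.
exact: sphere_moduleC.
Qed.

(** With e = 1 or -1, the square of 1 + e x_i plus the squares of the other
    variables is 2 (1 + e x_i) plus the equation of the sphere. *)
Lemma sphere_module_coord V (i : 'I_k) (e : R) :
  i \in V -> e ^+ 2 = 1 -> sphere_module V (2^-1 *: (1 + e *: 'X_i)).
Proof.
move=> iV e1.
exists (4^-1 *: ((1 + e *: 'X_i) ^+ 2 + \sum_(j in V | j != i) 'X_j ^+ 2)).
exists (- 4^-1)%:MP; split; last 1 first.
- rewrite /sphere (bigD1 i iV) /=; set S := \sum_(j in V | _) _.
  rewrite -!mul_mpolyC.
  have e1' : e%:MP ^+ 2 = 1 :> {mpoly R[k]} by rewrite -rmorphXn e1.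
  have -> : (2^-1)%:MP = 2 * (4^-1)%:MP :> {mpoly R[k]}.
    have -> : (2 : {mpoly R[k]}) = 2%:MP by rewrite rmorphMn rmorph1.
    by rewrite -rmorphM; congr (_ %:MP); field.
  rewrite rmorphN /=.
  transitivity ((4^-1)%:MP * ((1 + e%:MP * 'X_i) ^+ 2
      + (1 - e%:MP ^+ 2 * 'X_i ^+ 2)) : {mpoly R[k]}); first by ring.
  by rewrite e1'; ring.
- apply: sos_in_varsZ; first lra.
  apply: sos_in_varsD.
    apply: sos_in_vars_sqr; apply: in_varsD; first exact: in_vars1.
    by apply: in_varsZ; exact: in_varsX.
  apply: (big_ind (sos_in_vars V)) => [| |j /andP[jV _]].
  + exact: sos_in_vars0.
  + exact: sos_in_varsD.
  + by apply: sos_in_vars_sqr; exact: in_varsX.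
- exact: in_varsC.
Qed.

End SphereModule.

(** * Bernstein polynomials in one variable *)

Section Bernstein.
Variable R : realType.

(** The coefficients of X^a in the Bernstein basis of degree N on [-1,1], by
    recursion on a: multiplication by X = (1+X)/2 - (1-X)/2 raises the degree of
    the basis by one, see [bernstein_mulX].  For a <= N the truncated predecessor
    of 0 and the index N of degree N - 1 only occur with weight 0. *)
Fixpoint bernstein_coef (a N j : nat) : R :=
  if a is a'.+1 then
    (j%:R * bernstein_coef a' N.-1 j.-1
     - (N - j)%:R * bernstein_coef a' N.-1 j) / N%:R
  else 1.

(** The point 2 j / N - 1 of [-1,1], written in the form that the recursion for
    the coefficients produces. *)
Definition node (N j : nat) : R := (j%:R - (N - j)%:R) / N%:R.

Lemma node_le1 N j : (j <= N)%N -> `|node N j| <= 1.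
Proof.
move=> jN; rewrite /node natrB //.
case: N jN => [|N] jN; first by rewrite invr0 mulr0 normr0.
have N0 : 0 < N.+1%:R :> R by [].
have j0 : 0 <= j%:R :> R by [].
have : j%:R <= N.+1%:R :> R by rewrite ler_nat.
by move=> ?; rewrite ler_norml ler_pdivlMr // ler_pdivrMr //; lra.
Qed.

Lemma bernstein_coef_le1 a N j : (j <= N)%N -> `|bernstein_coef a N j| <= 1.
Proof.
elim: a N j => [|a IH] N j jN /=; first by rewrite normr1.
case: N jN => [|N] jN; first by rewrite invr0 mulr0 normr0.
have N0 : 0 < N.+1%:R :> R by [].
have h1 : `|j%:R * bernstein_coef a N j.-1| <= j%:R.
  rewrite normrM ger0_norm //; apply: ler_piMr => //; apply: IH.
  by case: j jN.
have h2 : `|(N.+1 - j)%:R * bernstein_coef a N j| <= (N.+1 - j)%:R.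
  rewrite normrM ger0_norm //.
  have [jN'|jN'] := leqP j N; first by apply: ler_piMr => //; exact: IH.
  have -> : (N.+1 - j = 0)%N by apply/eqP; rewrite subn_eq0.
  by rewrite mul0r.
rewrite normrM normfV (ger0_norm (ltW N0)) ler_pdivrMr // mul1r.
apply: le_trans (ler_normB _ _) _; apply: le_trans (lerD h1 h2) _.
by rewrite -natrD subnKC.
Qed.

Lemma subX_le (u v : R) a : `|u| <= 1 -> `|v| <= 1 ->
  `|u ^+ a - v ^+ a| <= a%:R * `|u - v|.
Proof.
move=> u1 v1; elim: a => [|a IH]; first by rewrite !expr0 subrr normr0 mul0r.
have -> : u ^+ a.+1 - v ^+ a.+1 = u * (u ^+ a - v ^+ a) + (u - v) * v ^+ a.
  by rewrite !exprS; ring.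
apply: le_trans (ler_normD _ _) _; rewrite !normrM -natr1 mulrDl mul1r.
apply: lerD; first by apply: le_trans IH; exact: ler_piMl.
by apply: ler_piMr => //; rewrite normrX exprn_ile1.
Qed.

(** Both nodes of degree N - 1 from which the recursion computes the j-th
    coefficient are within 2 / N of the j-th node of degree N. *)
Lemma node_pred N j : (j <= N)%N -> (1 < N)%N ->
  ((0 < j)%N -> `|node N.-1 j.-1 - node N j| <= 2 / N%:R)
  /\ ((j < N)%N -> `|node N.-1 j - node N j| <= 2 / N%:R).
Proof.
case: N => [//|[//|N]] jN _ /=; rewrite /node.
have N0 : 0 < N.+1%:R :> R by [].
have N1 : 0 < N.+2%:R :> R by [].
have NE : N.+2%:R = N.+1%:R + 1 :> R by rewrite -natr1.
have jR : j%:R <= N.+2%:R :> R by rewrite ler_nat.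
split.
- case: j jN jR => // j jN jR _ /=; rewrite !natrB //.
  have jE : j.+1%:R = j%:R + 1 :> R by rewrite -natr1.
  have j0 : 0 <= j%:R :> R by [].
  have -> : (j%:R - (N.+1%:R - j%:R)) / N.+1%:R
     - (j.+1%:R - (N.+1%:R - j%:R)) / N.+2%:R
     = - ((N.+1%:R - j%:R) / N.+1%:R) * (2 / N.+2%:R) :> R.
    by rewrite jE NE; field; rewrite !lt0r_neq0 //; have := ler0n R N; lra.
  rewrite normrM normrN (ger0_norm (_ : 0 <= 2 / _)) ?divr_ge0 //.
  apply: ler_piMl; first by rewrite divr_ge0.
  rewrite jE NE in jR.
  by rewrite ger0_norm ?ler_pdivrMr ?divr_ge0 //; lra.
- move=> jN'; rewrite !natrB //.
  have jR' : j%:R <= N.+1%:R :> R by rewrite ler_nat.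
  have -> : (j%:R - (N.+1%:R - j%:R)) / N.+1%:R
     - (j%:R - (N.+2%:R - j%:R)) / N.+2%:R
     = (j%:R / N.+1%:R) * (2 / N.+2%:R) :> R.
    by rewrite NE; field; rewrite !lt0r_neq0 //; have := ler0n R N; lra.
  rewrite normrM (ger0_norm (_ : 0 <= 2 / _)) ?divr_ge0 //.
  apply: ler_piMl; first by rewrite divr_ge0.
  by rewrite ger0_norm ?ler_pdivrMr ?divr_ge0 //; lra.
Qed.

(** A constant K with error at most K / N in [bernstein_coef_node].  The factor
    2 absorbs the passage from K / (N - 1) to K / N. *)
Fixpoint bernstein_err (a : nat) : R :=
  if a is a'.+1 then 2 * bernstein_err a' + 2 * a'%:R else 0.

Lemma bernstein_err_ge0 a : 0 <= bernstein_err a.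
Proof. by elim: a => //= a IH; rewrite addr_ge0 ?mulr_ge0. Qed.

(** The recursion is a combination of two coefficients of X^a with weights
    j / N and - (N - j) / N, which add up to the node y; replacing both
    coefficients by y^a gives y^(a+1). *)
Lemma bernstein_coef_node a N j : (a < N)%N -> (j <= N)%N ->
  `|bernstein_coef a N j - node N j ^+ a| <= bernstein_err a / N%:R.
Proof.
elim: a N j => [|a IH] N j aN jN /=; first by rewrite expr0 subrr normr0 mul0r.
have K0 := bernstein_err_ge0 a; set K := bernstein_err a in IH K0 *.
have N1 : (1 < N)%N by apply: leq_ltn_trans aN.
have [np1 np2] := node_pred jN N1.
case: N N1 aN jN np1 np2 => [//|[//|N]] _ aN jN np1 np2 /=.
have N0 : 0 < N.+2%:R :> R by [].
(* the error of X^a at degree N+1, plus the effect of moving the node *)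
pose e : R := K / N.+1%:R + a%:R * (2 / N.+2%:R).
have e0 : 0 <= e by rewrite addr_ge0 ?mulr_ge0 ?invr_ge0.
have Ha m : (m <= N.+1)%N -> `|node N.+1 m - node N.+2 j| <= 2 / N.+2%:R ->
    `|bernstein_coef a N.+1 m - node N.+2 j ^+ a| <= e.
  move=> mN h.
  have -> : bernstein_coef a N.+1 m - node N.+2 j ^+ a =
    (bernstein_coef a N.+1 m - node N.+1 m ^+ a)
    + (node N.+1 m ^+ a - node N.+2 j ^+ a) by ring.
  apply: le_trans (ler_normD _ _) _; apply: lerD; first exact: IH.
  apply: le_trans (subX_le _ (node_le1 mN) (node_le1 jN)) _.
  by apply: ler_wpM2l.
set b1 := bernstein_coef _ _ j.-1; set b2 := bernstein_coef _ _ j.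
set y := node _ _.
have yE : y = (j%:R - (N.+2 - j)%:R) / N.+2%:R by [].
have -> : (j%:R * b1 - (N.+2 - j)%:R * b2) / N.+2%:R - y ^+ a.+1 =
  (j%:R * (b1 - y ^+ a) - (N.+2 - j)%:R * (b2 - y ^+ a)) / N.+2%:R.
  by rewrite exprS {1}yE; field; rewrite -?natrD ?pnatr_eq0.
have h1 : `|j%:R * (b1 - y ^+ a)| <= j%:R * e.
  case: (posnP j) => [->|j0]; first by rewrite !mul0r normr0.
  rewrite normrM ger0_norm //; apply: ler_wpM2l => //; apply: Ha (np1 j0).
  by case: (j) jN.
have h2 : `|(N.+2 - j)%:R * (b2 - y ^+ a)| <= (N.+2 - j)%:R * e.
  have [jN'|jN'] := leqP j N.+1.
    rewrite normrM ger0_norm //; apply: ler_wpM2l => //; exact: Ha (np2 jN').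
  have -> : (N.+2 - j = 0)%N by apply/eqP; rewrite subn_eq0.
  by rewrite !mul0r normr0.
rewrite normrM normfV (ger0_norm (ltW N0)) ler_pdivrMr //.
apply: le_trans (ler_normB _ _) _; apply: le_trans (lerD h1 h2) _.
rewrite -mulrDl -natrD subnKC // mulrC ler_wpM2r //.
rewrite /e [leRHS]mulrDl lerD //; last first.
  by rewrite mulrCA mulrA.
rewrite [2 * K]mulrC -mulrA ler_wpM2l // ler_pdivlMr // mulrC ler_pdivrMr //.
by rewrite -[2]/(2%:R) -natrM ler_nat mul2n -addnn addSnnS leq_addl.
Qed.

Variable A : comAlgType R.
Implicit Type X : A.

(** The Bernstein polynomials of the interval [-1,1]. *)
Definition bernstein (N j : nat) X : A :=
  'C(N, j)%:R *: ((2^-1 *: (1 + X)) ^+ j * (2^-1 *: (1 - X)) ^+ (N - j)).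

Lemma bernstein_sum1 N X : \sum_(j < N.+1) bernstein N j X = 1.
Proof.
rewrite -[RHS](expr1n _ N).
have -> : 1 = 2^-1 *: (1 - X) + 2^-1 *: (1 + X) :> A.
  rewrite -scalerDr; have -> : 1 - X + (1 + X) = 2%:R *: 1.
    by rewrite scaler_nat addrACA addNr addr0 mulr2n.
  by rewrite scalerA mulVf ?scale1r // pnatr_eq0.
rewrite exprDn; apply: eq_bigr => j _.
by rewrite /bernstein scaler_nat mulrC.
Qed.

Lemma bernstein_mulX N j X : (j <= N)%N ->
  X * bernstein N j X = (j.+1%:R / N.+1%:R) *: bernstein N.+1 j.+1 X
    - ((N.+1 - j)%:R / N.+1%:R) *: bernstein N.+1 j X.
Proof.
move=> jN; rewrite /bernstein subSS subSn //.
set up := 2^-1 *: (1 + X); set dn := 2^-1 *: (1 - X).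
have XE : X = up - dn.
  rewrite /up /dn -scalerBr; have -> : 1 + X - (1 - X) = 2%:R *: X.
    by rewrite scaler_nat opprB addrC addrA addrNK mulr2n.
  by rewrite scalerA mulVf ?scale1r // pnatr_eq0.
have N0 : N.+1%:R != 0 :> R by rewrite pnatr_eq0.
rewrite !scalerA.
have -> : j.+1%:R / N.+1%:R * 'C(N.+1, j.+1)%:R = 'C(N, j)%:R :> R.
  by rewrite mulrAC -natrM -mul_bin_diag natrM mulrC mulKf.
have -> : (N - j).+1%:R / N.+1%:R * 'C(N.+1, j)%:R = 'C(N, j)%:R :> R.
  rewrite mulrAC -natrM -subSn //.
  by rewrite -mul_bin_down natrM mulrC mulKf.
rewrite -scalerBr -scalerAr {1}XE; congr (_ *: _).
by rewrite !exprS; ring.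
Qed.

Lemma bernstein_expX a N X : (a <= N)%N ->
  X ^+ a = \sum_(j < N.+1) bernstein_coef a N j *: bernstein N j X.
Proof.
elim: a N => [|a IH] N aN.
  rewrite expr0 -[LHS](bernstein_sum1 N X).
  by apply: eq_bigr => j _; rewrite scale1r.
case: N aN => // N aN; rewrite exprS (IH N) // mulr_sumr.
transitivity (\sum_(j < N.+1)
   ((j.+1%:R * bernstein_coef a N j / N.+1%:R) *: bernstein N.+1 j.+1 X
    - ((N.+1 - j)%:R * bernstein_coef a N j / N.+1%:R) *: bernstein N.+1 j X)).
  apply: eq_bigr => j _; rewrite -scalerAr bernstein_mulX; last by rewrite -ltnS.
  rewrite scalerBr !scalerA.
  have E (u : R) : bernstein_coef a N j * (u / N.+1%:R)
      = u * bernstein_coef a N j / N.+1%:R.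
    by rewrite mulrA [_ * u]mulrC.
  by rewrite !E.
rewrite sumrB.
under [RHS]eq_bigr do rewrite /= mulrBl scalerBl.
rewrite sumrB; congr (_ - _).
  by rewrite [RHS]big_ord_recl /= !mul0r scale0r add0r.
by rewrite [RHS]big_ord_recr /= subnn !mul0r scale0r addr0.
Qed.

End Bernstein.

(** * Gluing nonnegative functions along cliques *)

Section Gluing.
Variables (R : realType) (k p : nat) (T : finType) (I : 'I_p -> {set 'I_k}).
Notation grid := {ffun 'I_k -> T}.
Implicit Types (V W : {set 'I_k}) (c : grid -> R) (j : grid).

Definition agree V : rel grid := fun j j' => [forall i in V, j i == j' i].

Definition depends_on V c := forall j j', agree V j j' -> c j = c j'.

Lemma agreeP V j j' : reflect {in V, j =1 j'} (agree V j j').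
Proof. by apply: (iffP forall_inP) => h i /h /eqP. Qed.

Lemma agree_sub V W j j' : V \subset W -> agree W j j' -> agree V j j'.
Proof. by move=> /subsetP VW /agreeP h; apply/agreeP => i /VW; exact: h. Qed.

(** The minimum over the coordinates outside V, as a function of those in V. *)
Lemma partial_min V c : exists phi : grid -> R,
  [/\ depends_on V phi, forall j, phi j <= c j &
      forall j, exists2 j', agree V j j' & phi j = c j'].
Proof.
have agg j : agree V j j by apply/agreeP.
pose phi j := c [arg min_(j' < j | agree V j j') c j']%O.
have phiP j : (exists2 j', agree V j j' & phi j = c j')
    /\ forall j', agree V j j' -> phi j <= c j'.
  by rewrite /phi; case: arg_minP => // j' jj' h; split => //; exists j'.
exists phi; split=> [j1 j2 /agreeP j12|j|j]; last 2 first.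
- exact: (phiP j).2 (agg j).
- exact: (phiP j).1.
have [[a1 /agreeP ja1 e1] m1] := phiP j1.
have [[a2 /agreeP ja2 e2] m2] := phiP j2.
apply/eqP; rewrite eq_le {2}e1 e2; apply/andP; split.
  by apply: m1; apply/agreeP => i iV; rewrite j12 ?ja2.
by rewrite -e2; apply: m2; apply/agreeP => i iV; rewrite -j12 ?ja1.
Qed.

(** Induction on the number of cliques; the last function is made nonnegative by
    moving its partial minimum over the unshared coordinates to an earlier
    clique.  The remaining sum stays nonnegative because a grid point of the
    earlier cliques and a minimizer of the last function agree on the shared
    coordinates and can be merged. *)
Lemma running_intersection_glue (rip : running_intersection I)
    (c : 'I_p -> grid -> R) :
    (forall l, depends_on (I l) (c l)) ->
    (forall j, 0 <= \sum_(l < p) c l j) ->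
  exists c' : 'I_p -> grid -> R,
    [/\ forall l, depends_on (I l) (c' l), forall l j, 0 <= c' l j &
        forall j, \sum_(l < p) c' l j = \sum_(l < p) c l j].
Proof.
suff H q (c0 : 'I_p -> grid -> R) : (q <= p)%N ->
    (forall l, depends_on (I l) (c0 l)) ->
    (forall j, 0 <= \sum_(l < p | (l < q)%N) c0 l j) ->
  exists c' : 'I_p -> grid -> R,
    [/\ forall l, depends_on (I l) (c' l),
        forall (l : 'I_p) j, (l < q)%N -> 0 <= c' l j &
        forall j, \sum_(l < p | (l < q)%N) c' l j
                  = \sum_(l < p | (l < q)%N) c0 l j].
  move=> cI c0.
  have E (b : 'I_p -> grid -> R) j :
      \sum_(l < p) b l j = \sum_(l < p | (l < p)%N) b l j.
    by apply: eq_bigl => l; rewrite ltn_ord.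
  have [|c' [dc' pc' ec']] := H p c (leqnn p) cI; first by move=> j; rewrite -E.
  exists c'; split=> // [l j|j]; first exact: pc'.
  by rewrite !E.
elim: q c0 => [|q IH] c0 qp cI c0ge.
  by exists c0; split.
pose m : 'I_p := Ordinal qp.
have splitm (b : 'I_p -> grid -> R) j : \sum_(l < p | (l < q.+1)%N) b l j
    = b m j + \sum_(l < p | (l < q)%N) b l j.
  rewrite (bigD1 m) //=; congr (_ + _); apply: eq_bigl => l.
  by rewrite ltnS -val_eqE /= ltn_neqAle andbC.
case: (posnP q) => [q0|q0].
  exists c0; split=> // l j lq; have := c0ge j.
  rewrite splitm [X in _ + X]big_pred0 => [|i]; last by rewrite q0.
  rewrite addr0; suff -> : l = m by [].
  by apply/val_inj => /=; move: lq; rewrite ltnS q0 leqn0 => /eqP.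
have [s sq Js] := rip m q0.
set U := \bigcup_(j < p | _) _ in Js.
have [phi [dphi phile phiat]] := partial_min (I m :&: U) (c0 m).
have sm : s != m by rewrite -val_eqE /= ltn_eqF.
pose c1 l j := if l == m then c0 m j - phi j
               else if l == s then c0 s j + phi j else c0 l j.
have c1m j : c1 m j = c0 m j - phi j by rewrite /c1 eqxx.
have c1sum j : \sum_(l < p | (l < q)%N) c1 l j =
    phi j + \sum_(l < p | (l < q)%N) c0 l j.
  rewrite (bigD1 s) // [in RHS](bigD1 s) //= /c1 (negPf sm) eqxx.
  rewrite addrA [phi j + _]addrC; congr (_ + _); apply: eq_bigr => l /andP[lq ls].
  by rewrite (negPf ls) -val_eqE /= (ltn_eqF lq).
have c1I l : depends_on (I l) (c1 l).
  move=> j j' jj'; rewrite /c1; case: eqP => [lm|_].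
    rewrite lm in jj'; congr (_ - _); first exact: cI.
    by apply: dphi; apply: agree_sub jj'; exact: subsetIl.
  case: eqP => [ls|_]; last exact: cI.
  rewrite ls in jj'; congr (_ + _); first exact: cI.
  by apply: dphi; apply: agree_sub jj'.
have [|c2 [c2I c2ge c2sum]] := IH c1 (ltnW qp) c1I.
  move=> j; rewrite c1sum; have [a /agreeP ja ->] := phiat j.
  (* j on the earlier cliques, merged with a minimizer on the last one *)
  pose b : grid := [ffun i => if i \in U then j i else a i].
  have := c0ge b; rewrite splitm.
  have -> : c0 m b = c0 m a.
    apply: cI; apply/agreeP => i im; rewrite ffunE; case: ifP => // iU.
    by apply: ja; rewrite inE im iU.
  congr (0 <= _ + _); apply: eq_bigr => l lq; apply: cI; apply/agreeP => i il.
  rewrite ffunE; suff -> : i \in U by [].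
  by apply/bigcupP; exists l.
exists (fun l j => if l == m then c0 m j - phi j else c2 l j); split.
- move=> l; case: eqP => [->|_]; last exact: c2I.
  by move=> j j' /(c1I m); rewrite !c1m.
- move=> l j lq; case: eqP => [_|/eqP lm]; first by rewrite subr_ge0.
  by apply: c2ge; rewrite ltn_neqAle -ltnS lq andbT; move: lm; rewrite -val_eqE.
- move=> j; rewrite splitm.
  rewrite (splitm (fun l j => if l == m then c0 m j - phi j else c2 l j)) eqxx.
  transitivity (c0 m j - phi j + \sum_(l < p | (l < q)%N) c2 l j).
    congr (_ + _); apply: eq_bigr => l lq.
    by rewrite -val_eqE /= (ltn_eqF lq).
  by rewrite c2sum c1sum; ring.
Qed.

End Gluing.

(** * Compactness of the cube *)

Section Compactness.
Import boolp classical_sets filter topology normedtype.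
Import numFieldNormedType.Exports.
Variables (R : realType) (k : nat).
Implicit Types (q h : {mpoly R[k]}) (v : 'rV[R]_k).
Local Open Scope classical_set_scope.
Local Open Scope ring_scope.

Lemma meval_continuous q : continuous (fun v : 'rV[R]_k => q.@[v 0]).
Proof.
move=> v; have FF : Filter (nbhs v) by exact: nbhs_filter.
rewrite /continuous_at mevalE.
under eq_fun do rewrite mevalE.
apply: cvg_big => [|m _]; first exact: add_continuous.
apply: cvgM; first exact: cvg_cst.
apply: cvg_big => [|i _]; first exact: mul_continuous.
elim: (m i) => [|a IH].
  by rewrite expr0; under eq_fun do rewrite expr0; exact: cvg_cst.
rewrite exprS; under eq_fun do rewrite exprS.
by apply: cvgM IH; exact: coord_continuous.
Qed.

(** The open sets q + (N+1) h > 1 / (N+1) increase with N and cover the cube;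
    by compactness one of them is enough. *)
Lemma cube_penalty q h :
    (forall v, 0 <= h.@[v 0]) ->
    (forall v, (forall i, `|v 0 i| <= 1) -> h.@[v 0] = 0 -> 0 < q.@[v 0]) ->
  exists C delta : R, [/\ 0 <= C, 0 < delta &
    forall v, (forall i, `|v 0 i| <= 1) -> delta <= q.@[v 0] + C * h.@[v 0]].
Proof.
move=> h0 qh.
have cK : compact [set v : 'rV[R]_k | forall i, v ord0 i \in `[-1, 1]].
  exact (@rV_compact R k (fun=> `[-1, 1]%classic) (fun=> @segment_compact R _ _)).
set K := [set v | _] in cK.
have near_cover : \forall N \near \oo, K `<=` [set v |
    N.+1%:R^-1 < q.@[v 0] + N.+1%:R * h.@[v 0]].
  move/compact_near_coveringP : cK; apply => v Kv.
  have hv := @meval_continuous h v; have qv := @meval_continuous q v.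
  have FF : Filter (nbhs v) by exact: nbhs_filter.
  have [hv0|hv0] := ltP 0 h.@[v 0].
    have hv2 : h.@[v 0] / 2 < h.@[v 0] by lra.
    have qv1 : q.@[v 0] - 1 < q.@[v 0] by lra.
    have A := cvgr_gt _ hv _ hv2; have B := cvgr_gt _ qv _ qv1.
    near=> u N => /=.
    have hu : h.@[v 0] / 2 < h.@[u 0] by near: u; exact: A.
    have qu : q.@[v 0] - 1 < q.@[u 0] by near: u; exact: B.
    have NC : (2 - q.@[v 0]) / (h.@[v 0] / 2) < N%:R.
      by near: N; exact: nbhs_infty_gtr.
    rewrite ltr_pdivrMr ?divr_gt0 // in NC.
    have N1 : N.+1%:R^-1 <= 1 :> R by rewrite invf_le1 // ler1n.
    have NE : N.+1%:R = N%:R + 1 :> R by rewrite -natr1.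
    have N0 : 0 <= N%:R :> R by [].
    apply: le_lt_trans N1 _; rewrite NE; nra.
  have hvE : h.@[v 0] = 0 by apply/le_anti; rewrite hv0 h0.
  have qv0 : 0 < q.@[v 0].
    by apply: qh hvE => i; rewrite ler_norml; have := Kv i; rewrite in_itv.
  have qv2 : q.@[v 0] / 2 < q.@[v 0] by lra.
  have B := cvgr_gt _ qv _ qv2.
  near=> u N => /=.
  have qu : q.@[v 0] / 2 < q.@[u 0] by near: u; exact: B.
  have NC : N.+1%:R^-1 < q.@[v 0] / 2.
    rewrite invf_plt ?posrE ?divr_gt0 //.
    have : (q.@[v 0] / 2)^-1 < N%:R by near: N; exact: nbhs_infty_gtr.
    by move/lt_trans; apply; rewrite ltr_nat.
  by apply: lt_le_trans (lt_trans NC qu) _; rewrite lerDl mulr_ge0.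
case: near_cover => N _ /(_ N (leqnn N)) NP.
exists N.+1%:R, N.+1%:R^-1; split=> // [|v v1]; first by rewrite invr_gt0.
by apply/ltW/NP => i; rewrite in_itv /= -ler_norml.
Unshelve. all: by end_near. Qed.

End Compactness.

(** * Bernstein polynomials in several variables *)

Lemma prod_sub_le (R : realType) (T : Type) (s : seq T) (u v : T -> R) :
    (forall t, `|u t| <= 1) -> (forall t, `|v t| <= 1) ->
  `|\prod_(t <- s) u t - \prod_(t <- s) v t| <= \sum_(t <- s) `|u t - v t|.
Proof.
move=> u1 v1; elim: s => [|t s IH]; first by rewrite !big_nil subrr normr0.
rewrite !big_cons; set U := \prod_(_ <- _) u _; set V := \prod_(_ <- _) v _.
have V1 : `|V| <= 1.
  by rewrite /V normr_prod; apply: prodr_ile1 => i _; rewrite normr_ge0 v1.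
have -> : u t * U - v t * V = (u t - v t) * V + u t * (U - V) by ring.
apply: le_trans (ler_normD _ _) _; rewrite !normrM; apply: lerD.
  exact: ler_piMr.
by apply: le_trans IH; exact: ler_piMl.
Qed.

Section MultivariateBernstein.
Variables (R : realType) (k : nat).
Implicit Types (V : {set 'I_k}) (q : {mpoly R[k]}).

Definition mbernstein N (j : {ffun 'I_k -> 'I_N.+1}) : {mpoly R[k]} :=
  \prod_i bernstein N (j i) ('X_i : {mpoly R[k]}).

Definition mbernstein_coef q N (j : {ffun 'I_k -> 'I_N.+1}) : R :=
  \sum_(m <- msupp q) q@_m * \prod_i bernstein_coef R (m i) N (j i).

Definition mbernstein_err q : R :=
  \sum_(m <- msupp q) `|q@_m| * \sum_i bernstein_err R (m i).

Lemma mbernstein_err_ge0 q : 0 <= mbernstein_err q.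
Proof.
apply: sumr_ge0 => m _; apply: mulr_ge0 => //.
by apply: sumr_ge0 => i _; exact: bernstein_err_ge0.
Qed.

Lemma exponent_lt_msize q m i : m \in msupp q -> (m i < msize q)%N.
Proof.
move=> mq; apply: leq_ltn_trans (msize_mdeg_lt mq).
by rewrite mdegE (bigD1 i) //= leq_addr.
Qed.

Lemma mbernstein_expansion q N : (msize q <= N)%N ->
  q = \sum_(j : {ffun 'I_k -> 'I_N.+1}) mbernstein_coef q j *: mbernstein j.
Proof.
move=> qN; rewrite {1}[q]mpolyE.
under [RHS]eq_bigr do rewrite scaler_suml.
rewrite exchange_big /= !big_seq; apply: eq_bigr => m mq.
rewrite mpolyXE_id.
rewrite (eq_bigr (fun i => \sum_(a < N.+1)
    bernstein_coef R (m i) N a *: bernstein N a ('X_i : {mpoly R[k]}))); last first.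
  move=> i _; apply: bernstein_expX; apply: ltnW.
  exact: leq_trans (exponent_lt_msize i mq) qN.
rewrite bigA_distr_bigA scaler_sumr; apply: eq_bigr => j _.
by rewrite scaler_prod scalerA.
Qed.

Lemma mbernstein_coef_near q N (j : {ffun 'I_k -> 'I_N.+1}) :
  (msize q <= N)%N ->
  `|mbernstein_coef q j - q.@[fun i => node R N (j i)]|
    <= mbernstein_err q / N%:R.
Proof.
move=> qN; rewrite mevalE -sumrB.
apply: le_trans (ler_norm_sum _ _ _) _; rewrite mulr_suml.
rewrite big_seq [leRHS]big_seq; apply: ler_sum => m mq.
rewrite -mulrBr normrM -mulrA; apply: ler_wpM2l => //.
have jN i : (j i <= N)%N by rewrite -ltnS.
apply: le_trans (prod_sub_le _ _ _) _ => [i|i|].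
- exact: bernstein_coef_le1.
- by rewrite normrX exprn_ile1 // node_le1.
rewrite mulr_suml; apply: ler_sum => i _; apply: bernstein_coef_node => //.
exact: leq_trans (exponent_lt_msize i mq) qN.
Qed.

(** A variable that does not occur has exponent 0, and all the coefficients of
    X^0 are 1. *)
Lemma depends_on_mbernstein_coef V q N :
  in_vars V q -> depends_on V (@mbernstein_coef q N).
Proof.
move=> Vq j j' /agreeP jj'; apply: eq_big_seq => m mq.
congr (_ * _); apply: eq_bigr => i _.
have [iV|iV] := boolP (i \in V); first by rewrite jj'.
by rewrite (Vq _ mq _ iV).
Qed.

Lemma sphere_module_bernstein V i N a :
  i \in V -> sphere_module V (bernstein N a ('X_i : {mpoly R[k]})).
Proof.
move=> iV; apply: sphere_moduleZ => //.
apply: sphere_moduleM; apply: sphere_moduleXn.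
  by rewrite -['X_i]scale1r; apply: sphere_module_coord => //; rewrite expr1n.
by rewrite -scaleN1r; apply: sphere_module_coord => //; rewrite sqrrN expr1n.
Qed.

(** The sum over the grid coordinates outside V can be carried out first; it
    turns the Bernstein polynomials of the variables outside V into 1. *)
Lemma sphere_module_mbernstein V N (c : {ffun 'I_k -> 'I_N.+1} -> R) :
    depends_on V c -> (forall j, 0 <= c j) ->
  sphere_module V (\sum_j c j *: mbernstein j).
Proof.
move=> cV c0.
(* r j is the representative of the grid points that agree with j on V *)
pose r (j : {ffun 'I_k -> 'I_N.+1}) := [ffun i => if i \in V then j i else ord0].
rewrite (partition_big r predT) //=; apply: sphere_module_sum => j0 _.
have [j00|j00] := eqVneq (r j0) j0; last first.
  rewrite big_pred0 => [|j]; first by rewrite -mpolyC0; exact: sphere_moduleC.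
  apply/negbTE; apply: contra j00 => /eqP <-; apply/eqP/ffunP => i.
  by rewrite !ffunE; case: (i \in V).
pose Q i := [pred a : 'I_N.+1 | (i \in V) ==> (a == j0 i)].
have rQ j : (r j == j0) = (j \in family Q).
  apply/eqP/familyP => [rj i|jQ].
    by rewrite inE -rj ffunE; case: (i \in V) => /=.
  apply/ffunP => i; rewrite -[in RHS]j00 !ffunE; case: ifP => // iV.
  by have := jQ i; rewrite inE iV => /eqP.
have -> : \sum_(j | r j == j0) c j *: mbernstein j
    = c j0 *: \prod_i \sum_(a | Q i a) bernstein N a ('X_i : {mpoly R[k]}).
  rewrite bigA_distr_big_dep scaler_sumr; apply: eq_big => j; first exact: rQ.
  rewrite rQ => /familyP jQ; congr (_ *: _); apply: cV; apply/agreeP => i iV.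
  by have := jQ i; rewrite inE iV => /eqP.
apply: sphere_moduleZ => //; apply: sphere_module_prod => i _.
have [iV|iV] := boolP (i \in V).
  by apply: sphere_module_sum => a _; exact: sphere_module_bernstein.
rewrite (eq_bigl xpredT) => [|a]; last by rewrite inE (negPf iV).
by rewrite bernstein_sum1; exact: sphere_moduleC.
Qed.

End MultivariateBernstein.

(** * The sparse Putinar theorem for spheres *)

(** The penalty C sum_l g_l^2 extends the positivity from the common zeros of
    the g_l to the whole cube; it is undone at the end by subtracting C g_l from
    the multiplier of g_l. *)
Theorem sparse_putinar_spheres (R : realType) (k p : nat)
    (I : 'I_p -> {set 'I_k}) (ql : 'I_p -> {mpoly R[k]}) :
    running_intersection I -> (forall l, in_vars (I l) (ql l)) ->
    (forall v : 'rV[R]_k, (forall l, (sphere R (I l)).@[v 0] = 0) ->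
       0 < (\sum_(l < p) ql l).@[v 0]) ->
  exists sigma tau : 'I_p -> {mpoly R[k]},
    [/\ forall l, sos_in_vars (I l) (sigma l),
        forall l, in_vars (I l) (tau l) &
        \sum_(l < p) ql l = \sum_(l < p) (sigma l + tau l * sphere R (I l))].
Proof.
move=> rip qI qpos.
pose g l := sphere R (I l).
have gI l : in_vars (I l) (g l) by exact: in_vars_sphere.
have [C [delta [C0 delta0 Cdelta]]] : exists C delta : R,
    [/\ 0 <= C, 0 < delta & forall v : 'rV[R]_k, (forall i, `|v 0 i| <= 1) ->
    delta <= (\sum_(l < p) ql l).@[v 0] + C * (\sum_(l < p) g l ^+ 2).@[v 0]].
  have h0 (v : 'rV[R]_k) (P : pred 'I_p) :
      0 <= \sum_(l < p | P l) (g l ^+ 2).@[v 0].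
    by apply: sumr_ge0 => l _; rewrite rmorphXn sqr_ge0.
  apply: cube_penalty => [v|v _]; first by rewrite raddf_sum; exact: h0.
  move=> hv; apply: qpos => l; move: hv; rewrite raddf_sum (bigD1 l) //= => /eqP.
  rewrite paddr_eq0 ?h0 //; last by rewrite rmorphXn sqr_ge0.
  by rewrite rmorphXn sqrf_eq0 => /andP[/eqP].
pose F l := ql l + C *: g l ^+ 2.
have FI l : in_vars (I l) (F l).
  by apply: in_varsD => //; apply: in_varsZ; exact: in_varsXn.
have FE : \sum_(l < p) F l = \sum_(l < p) ql l + C *: \sum_(l < p) g l ^+ 2.
  by rewrite big_split scaler_sumr.
pose E := \sum_(l < p) mbernstein_err (F l).
have E0 : 0 <= E by apply: sumr_ge0 => l _; exact: mbernstein_err_ge0.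
(* large enough for the expansions to exist and for E / N <= delta *)
pose N := (Num.bound (E / delta) + \sum_(l < p) msize (F l))%N.
have FN l : (msize (F l) <= N)%N.
  by rewrite /N (bigD1 l) //= addnCA leq_addr.
have EN : E / N%:R <= delta.
  have NE : E / delta < N%:R.
    apply: lt_le_trans (archi_boundP _) _; first by rewrite divr_ge0 // ltW.
    by rewrite ler_nat leq_addr.
  have N0 : 0 < N%:R :> R by apply: le_lt_trans NE; rewrite divr_ge0 // ltW.
  by rewrite ler_pdivrMr // mulrC -ler_pdivrMr // ltW.
have coef_ge0 (j : {ffun 'I_k -> 'I_N.+1}) :
    0 <= \sum_(l < p) mbernstein_coef (F l) j.
  pose y : 'rV[R]_k := \row_i node R N (j i).
  have y1 i : `|y 0 i| <= 1 by rewrite mxE node_le1 // -ltnS.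
  have near l :
      (F l).@[y 0] - mbernstein_err (F l) / N%:R <= mbernstein_coef (F l) j.
    have := mbernstein_coef_near j (FN l).
    rewrite (@meval_eq _ _ _ (y 0)) => [|i]; last by rewrite mxE.
    by rewrite ler_norml => /andP[+ _]; lra.
  apply: le_trans (ler_sum _ (fun l _ => near l)).
  rewrite sumrB -mulr_suml -/E -raddf_sum /= FE mevalD mevalZ.
  by rewrite subr_ge0 (le_trans EN) ?Cdelta.
have [c [cI c0 cE]] :=
  running_intersection_glue rip (fun l => depends_on_mbernstein_coef (FI l))
    coef_ge0.
have /fin_all_exists[sigma /fin_all_exists[tau st]] l :=
  sphere_module_mbernstein (cI l) (c0 l).
exists sigma, (fun l => tau l - C *: g l); split=> [l|l|].
- by case: (st l).
- by case: (st l) => _ tauI _; apply: in_varsD => //; apply/in_varsN/in_varsZ.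
have -> : \sum_(l < p) ql l = \sum_(l < p) F l - C *: \sum_(l < p) g l ^+ 2.
  by rewrite FE addrK.
rewrite scaler_sumr.
transitivity (\sum_(l < p) (sigma l + tau l * g l) - \sum_(l < p) C *: g l ^+ 2).
  congr (_ - _).
  rewrite (eq_bigr _ (fun l _ => mbernstein_expansion (FN l))) exchange_big /=.
  under eq_bigr do rewrite -scaler_suml -cE scaler_suml.
  by rewrite exchange_big /=; apply: eq_bigr => l _; case: (st l).
rewrite -sumrB; apply: eq_bigr => l _.
by rewrite -!mul_mpolyC -/(g l); ring.
Qed.

(** * Polynomials that vanish everywhere *)

Section Vanishing.
Variable R : realType.

Lemma digits_inj B n (a b : nat -> nat) :
    (forall i, (a i < B)%N) -> (forall i, (b i < B)%N) ->
    (\sum_(i < n) a i * B ^ i)%N = (\sum_(i < n) b i * B ^ i)%N ->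
  forall i, (i < n)%N -> a i = b i.
Proof.
elim: n a b => // n IH a b aB bB.
rewrite !big_ord_recl !muln1.
have shift (u : nat -> nat) :
    (\sum_(i < n) u (lift ord0 i) * B ^ lift ord0 i
     = (\sum_(i < n) u i.+1 * B ^ i) * B)%N.
  rewrite big_distrl; apply: eq_bigr => i _.
  by rewrite /= /bump /= add1n expnSr mulnA.
rewrite !shift => ab.
have B0 : (0 < B)%N by exact: leq_ltn_trans (aB 0%N).
have ab0 : a 0%N = b 0%N.
  have := congr1 (modn^~ B) ab.
  by rewrite /= ![(_ 0%N + _)%N]addnC !modnMDl !modn_small.
case=> [_ //|i]; rewrite ltnS; apply: (IH (a \o succn) (b \o succn)) => //=.
by apply/eqP; rewrite -(eqn_pmul2r B0) -(eqn_add2l (a 0%N)) {2}ab0 ab.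
Qed.

Lemma poly_eq0 (P : {poly R}) : (forall t, P.[t] = 0) -> P = 0.
Proof.
move=> P0; apply/eqP; apply/negP => /negP nz.
have := max_poly_roots nz (rs := [seq i%:R | i <- iota 0 (size P)]).
rewrite size_map size_iota ltnn => absurd; suff: false by []; apply: absurd.
  by apply/allP => t _; exact/rootP.
by rewrite map_inj_uniq ?iota_uniq // => i j /eqP; rewrite eqr_nat => /eqP.
Qed.

(** Kronecker substitution x_i := t^(B^i): for B larger than all the exponents
    distinct monomials of f become distinct powers of t. *)
Lemma meval_eq0 n (f : {mpoly R[n]}) :
  (forall v : 'rV[R]_n, f.@[v 0] = 0) -> f = 0.
Proof.
move=> f0; pose B := msize f.
pose enc (m : 'X_{1..n}) := (\sum_(i < n) m i * B ^ i)%N.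
have enc_inj m m' : m \in msupp f -> m' \in msupp f -> enc m = enc m' -> m = m'.
  move=> mf mf' e; apply/mnmP => i.
  pose a (u : 'X_{1..n}) j := if insub j is Some j' then u j' else 0%N.
  have aE u (j : 'I_n) : a u j = u j by rewrite /a valK.
  have aB u j : u \in msupp f -> (a u j < B)%N.
    move=> uf; rewrite /a; case: insubP => [j' _ _|_]; first exact: exponent_lt_msize.
    exact: leq_ltn_trans (msize_mdeg_lt uf).
  rewrite -(aE m) -(aE m').
  apply: (@digits_inj B n) => // [j|j|]; [exact: aB|exact: aB|].
  transitivity (enc m); first by apply: eq_bigr => j _; rewrite aE.
  by rewrite e; apply: eq_bigr => j _; rewrite aE.
pose P : {poly R} := \sum_(m <- msupp f) f@_m *: 'X^(enc m).
have P0 : P = 0.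
  apply: poly_eq0 => t; rewrite -[RHS](f0 (\row_i t ^+ (B ^ i))) mevalE horner_sum.
  apply: eq_bigr => m _; rewrite hornerZ hornerXn; congr (_ * _).
  by rewrite /enc expr_sum; apply: eq_bigr => i _; rewrite mxE -exprM mulnC.
apply/eqP; rewrite -msupp_eq0; case E : (msupp f) => [//|m s].
have mf : m \in msupp f by rewrite E mem_head.
have := congr1 (fun Q : {poly R} => Q`_(enc m)) P0.
rewrite /P coef0 coef_sum (bigD1_seq m) ?msupp_uniq //= coefZ coefXn eqxx mulr1.
rewrite big_seq_cond big1 => [|m' /andP[m'f mm']]; last first.
  rewrite coefZ coefXn; case: eqP => [e|]; last by rewrite mulr0.
  by rewrite (enc_inj _ _ mf m'f e) eqxx in mm'.
by rewrite addr0 => /eqP; rewrite (negPf (_ : f@_m != 0)) // -mcoeff_msupp.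
Qed.

End Vanishing.

(** * Forms *)

Section Forms.
Variables (R : realType) (n d : nat) (f : {mpoly R[n]}).
Hypothesis f_form : f \is d.-homog.

Lemma dhomog_mevalZ (c : R) (v : 'rV[R]_n) : f.@[(c *: v) 0] = c ^+ d * f.@[v 0].
Proof.
rewrite !mevalE mulr_sumr !big_seq; apply: eq_bigr => m mf.
have <- : mdeg m = d by move/dhomogP: f_form => ->.
rewrite mdegE expr_sum [RHS]mulrCA -big_split; congr (_ * _).
by apply: eq_bigr => i _; rewrite mxE exprMn.
Qed.

(** If d were odd, f(-v) = - f(v) would force the nonnegative f to vanish
    everywhere. *)
Lemma psd_form_even :
  f != 0 -> (forall v : 'rV[R]_n, 0 <= f.@[v 0]) -> ~~ odd d.
Proof.
move=> f0 fge; apply: contraNN f0 => d_odd; apply/eqP/meval_eq0 => v.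
have := fge (- v); rewrite -scaleN1r dhomog_mevalZ -signr_odd d_odd mulN1r.
by rewrite oppr_ge0 => fle; apply/le_anti; rewrite fle fge.
Qed.

End Forms.

(** * Cliques with an auxiliary variable *)

Section Cliques.
Variables (R : realType) (n p : nat) (x : 'I_p -> {set 'I_n}).

Lemma lshift_clique_w i l : (lshift p i \in clique_w x l) = (i \in x l).
Proof.
rewrite /clique_w !inE eq_lrshift mem_imset //; exact: lshift_inj.
Qed.

Lemma rshift_clique_w l' l : (rshift n l' \in clique_w x l) = (l' == l).
Proof.
rewrite /clique_w !inE (inj_eq (@rshift_inj _ _)); case: eqP => //= _.
by apply/imsetP => -[i _ /eqP]; rewrite eq_rlshift.
Qed.

Lemma clique_sphereE l : clique_sphere R x l = sphere R (clique_w x l).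
Proof.
rewrite /clique_sphere /sphere /clique_w big_setU1 /=; last first.
  by apply/imsetP => -[i _ /eqP]; rewrite eq_rlshift.
rewrite big_imset /= => [|i j _ _]; last exact: lshift_inj.
by rewrite addrC; congr (_ - _); rewrite addrC.
Qed.

(** Each w_l belongs to one clique only, so it is never shared. *)
Lemma running_intersection_clique_w :
  running_intersection x -> running_intersection (clique_w x).
Proof.
move=> rip l l0; have [s sl /subsetP xs] := rip l l0; exists s => //.
apply/subsetP => t; rewrite inE => /andP[tl /bigcupP[j jl tj]].
case: (split_ordP t) tl tj => [i ->|l' ->].
  rewrite !lshift_clique_w => il ij; apply: xs; rewrite inE il /=.
  by apply/bigcupP; exists j.
by rewrite !rshift_clique_w => /eqP -> /eqP lj; rewrite lj ltnn in jl.
Qed.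

Lemma in_vars_embed l (q : {mpoly R[n]}) :
  in_vars (x l) q -> in_vars (clique_w x l) (embed_x p q).
Proof.
move=> qx; rewrite /embed_x comp_mpolyEX big_seq; apply: in_vars_sum => m mq.
apply: in_varsZ; rewrite comp_mpolyX; apply: in_vars_prod => i _.
have [il|il] := boolP (i \in x l); last by rewrite (qx _ mq _ il); exact: in_vars1.
by apply: in_varsXn; rewrite tnth_mktuple; apply: in_varsX; rewrite lshift_clique_w.
Qed.

Lemma meval_embed (q : {mpoly R[n]}) (v : 'rV[R]_(n + p)) :
  (embed_x p q).@[v 0] = q.@[(\row_i v 0 (lshift p i)) 0].
Proof.
rewrite /embed_x comp_mpoly_meval; apply: meval_eq => i.
by rewrite tnth_mktuple mevalXU mxE.
Qed.

End Cliques.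

(** * Sums of polynomials in the cliques *)

Section Sparse.
Variables (R : realType) (k p : nat) (I : 'I_p -> {set 'I_k}).

Definition sparse (q : {mpoly R[k]}) :=
  exists2 ql : 'I_p -> {mpoly R[k]},
    (forall l, in_vars (I l) (ql l)) & q = \sum_(l < p) ql l.

Lemma sparseD q q' : sparse q -> sparse q' -> sparse (q + q').
Proof.
move=> [ql qI ->] [ql' qI' ->]; exists (fun l => ql l + ql' l).
  by move=> l; exact: in_varsD.
by rewrite big_split.
Qed.

Lemma sparseZ c q : sparse q -> sparse (c *: q).
Proof.
move=> [ql qI ->]; exists (fun l => c *: ql l); last by rewrite scaler_sumr.
by move=> l; exact: in_varsZ.
Qed.

Lemma in_vars_sparse l q : in_vars (I l) q -> sparse q.
Proof.
move=> ql; exists (fun l' => if l' == l then q else 0).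
  by move=> l'; case: eqP => [->|_] //; exact: in_vars0.
by rewrite -big_mkcond big_pred1_eq.
Qed.

Lemma sparse_sum (T : finType) (F : T -> {mpoly R[k]}) :
  (forall t, sparse (F t)) -> sparse (\sum_t F t).
Proof.
move=> FI; apply: (big_ind sparse) => //; last exact: sparseD.
by exists (fun=> 0) => [l|]; [exact: in_vars0|rewrite big1].
Qed.

End Sparse.

(** * Sums of even powers and the theorem *)

Section EvenPowers.
Variables (R : realType) (d : nat).
Hypothesis d_even : ~~ odd d.

Lemma sum_even_ge0 (T : finType) (u : T -> R) : 0 <= \sum_t u t ^+ d.
Proof. by apply: sumr_ge0 => t _; exact: exprn_even_ge0. Qed.

Lemma sum_even_gt0 (T : finType) (u : T -> R) t :
  u t != 0 -> 0 < \sum_t u t ^+ d.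
Proof.
move=> ut; rewrite (bigD1 t) //=; apply: ltr_wpDr.
  by apply: sumr_ge0 => t' _; exact: exprn_even_ge0.
by rewrite exprn_even_gt0 // ut orbT.
Qed.

End EvenPowers.

(* In the first part the zero polynomial, which is homogeneous of every degree,
   is regarded as a form of degree d only for even d: for f = 0 and d odd the
   left-hand side of the identity takes negative values where all the
   constraints vanish.  For f != 0 the parity hypothesis is void. *)
Theorem theorem3p6 (R : realType) (n p d : nat) (n_gt0 : (0 < n)%N)
    (f : {mpoly R[n]}) (x : 'I_p -> {set 'I_n})
    (f_form : f \is d.-homog)
    (f_sparse : sparsity_pattern x f)
    (x_rip : running_intersection x) :
  ((f = 0 -> ~~ odd d) ->
   (forall v : 'rV[R]_n, 0 <= f.@[v 0]) ->
   forall eps : R, 0 < eps ->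
   exists sigma tau : 'I_p -> {mpoly R[n + p]},
     [/\ forall l, sos_in_vars (clique_w x l) (sigma l),
         forall l, in_vars (clique_w x l) (tau l) &
         embed_x p f
         + eps *: (\sum_(i < n) varx R p i ^+ d + \sum_(l < p) varw R n l ^+ d)
         = \sum_(l < p) (sigma l + tau l * clique_sphere R x l)])
  /\
  ((forall v : 'rV[R]_n, v != 0 -> 0 < f.@[v 0]) ->
   forall eps : R, 0 < eps ->
   exists sigma tau : 'I_p -> {mpoly R[n + p]},
     [/\ forall l, sos_in_vars (clique_w x l) (sigma l),
         forall l, in_vars (clique_w x l) (tau l) &
         embed_x p f + eps *: \sum_(l < p) varw R n l ^+ d
         = \sum_(l < p) (sigma l + tau l * clique_sphere R x l)]).
Proof.
have [x_cover f_split] := f_sparse.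
have cover (i : 'I_n) : exists l, i \in x l.
  have : i \in \bigcup_(l < p) x l by rewrite x_cover inE.
  by case/bigcupP => l _ il; exists l.
have [l0 _] := cover (Ordinal n_gt0).
have rip := running_intersection_clique_w x_rip.
have f_sp : sparse (clique_w x) (embed_x p f).
  case: f_split => fl flx ->; exists (fun l => embed_x p (fl l)).
    by move=> l; exact: in_vars_embed.
  by rewrite /embed_x raddf_sum.
have x_sp : sparse (clique_w x) (\sum_(i < n) varx R p i ^+ d).
  apply: sparse_sum => i; have [l il] := cover i.
  apply: (@in_vars_sparse _ _ _ _ l); apply: in_varsXn; apply: in_varsX.
  by rewrite lshift_clique_w.
have w_sp : sparse (clique_w x) (\sum_(l < p) varw R n l ^+ d).
  apply: sparse_sum => l.
  apply: (@in_vars_sparse _ _ _ _ l); apply: in_varsXn; apply: in_varsX.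
  by rewrite rshift_clique_w.
have x_ev (v : 'rV[R]_(n + p)) :
    (\sum_(i < n) varx R p i ^+ d).@[v 0] = \sum_(i < n) v 0 (lshift p i) ^+ d.
  by rewrite raddf_sum; apply: eq_bigr => i _; rewrite /= rmorphXn /= mevalXU.
have w_ev (v : 'rV[R]_(n + p)) :
    (\sum_(l < p) varw R n l ^+ d).@[v 0] = \sum_(l < p) v 0 (rshift n l) ^+ d.
  by rewrite raddf_sum; apply: eq_bigr => i _; rewrite /= rmorphXn /= mevalXU.
(* at a point of the sphere of l0 not all variables of that clique vanish *)
have on_sphere (v : 'rV[R]_(n + p)) :
    (sphere R (clique_w x l0)).@[v 0] = 0 ->
    (exists i, v 0 (lshift p i) != 0) \/ v 0 (rshift n l0) != 0.
  rewrite -clique_sphereE /clique_sphere mevalB mevalD meval1 raddf_sum.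
  rewrite rmorphXn /= mevalXU => /eqP; rewrite subr_eq0 => /eqP v1.
  have [/existsP|/existsPn v0] := boolP [exists i, v 0 (lshift p i) != 0].
    by left.
  right; apply: contra_eq_neq v1 => ->.
  rewrite big1 => [|i _]; first by rewrite add0r expr0n eq_sym oner_neq0.
  by rewrite rmorphXn /= mevalXU; have /negPn/eqP -> := v0 i; rewrite expr0n.
have conclude q : sparse (clique_w x) q ->
    (forall v : 'rV[R]_(n + p), (sphere R (clique_w x l0)).@[v 0] = 0 ->
      0 < q.@[v 0]) ->
  exists sigma tau : 'I_p -> {mpoly R[n + p]},
     [/\ forall l, sos_in_vars (clique_w x l) (sigma l),
         forall l, in_vars (clique_w x l) (tau l) &
         q = \sum_(l < p) (sigma l + tau l * clique_sphere R x l)].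
  move=> [ql qI ->] qpos.
  have [|sigma [tau [sI tI qE]]] := sparse_putinar_spheres rip qI.
    by move=> v /(_ l0); exact: qpos.
  exists sigma, tau; split=> //; rewrite qE.
  by apply: eq_bigr => l _; rewrite clique_sphereE.
split=> [f_zero f_psd eps eps0|f_pd eps eps0].
- have d_even : ~~ odd d.
    have [/f_zero//|f0] := eqVneq f 0; exact: psd_form_even f0 f_psd.
  apply: conclude => [|v /on_sphere vS]; first by do ?[apply: sparseD|apply: sparseZ].
  rewrite mevalD mevalZ mevalD x_ev w_ev meval_embed ltr_wpDl // mulr_gt0 //.
  case: vS => [[i vi]|vl].
    by rewrite ltr_wpDr ?sum_even_ge0 // (@sum_even_gt0 _ _ d_even _ _ i).
  by rewrite ltr_wpDl ?sum_even_ge0 // (@sum_even_gt0 _ _ d_even _ _ l0).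
pose e1 : 'rV[R]_n := const_mx 1.
have e1_neq0 : e1 != 0.
  by apply/eqP => /rowP /(_ (Ordinal n_gt0)); rewrite !mxE => /eqP; rewrite oner_eq0.
have f_psd (v : 'rV[R]_n) : 0 <= f.@[v 0].
  (* the value at 0 is 0^d times the value at any point, so it is covered too *)
  have [->|/f_pd/ltW//] := eqVneq v 0.
  rewrite -(scale0r e1) (dhomog_mevalZ f_form) mulr_ge0 ?exprn_ge0 //.
  exact: ltW (f_pd _ e1_neq0).
have f0 : f != 0.
  by apply/eqP => f0; have := f_pd _ e1_neq0; rewrite f0 meval0 ltxx.
have d_even := psd_form_even f_form f0 f_psd.
apply: conclude => [|v /on_sphere vS]; first by do ?[apply: sparseD|apply: sparseZ].
rewrite mevalD mevalZ w_ev meval_embed.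
case: vS => [[i vi]|vl].
  apply: ltr_wpDr; first by rewrite mulr_ge0 ?sum_even_ge0 // ltW.
  by apply: f_pd; apply/eqP => /rowP /(_ i); rewrite !mxE; exact/eqP.
apply: ltr_wpDl => //; apply: mulr_gt0 => //.
exact: (@sum_even_gt0 _ _ d_even _ _ l0).
Qed.
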